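(* Let $\mathbf{M} \in \mathbb{R}^{n \times n}$ be a symmetric positive semi-definite matrix. Suppose cross approximation is applied to $\mathbf{M}$ with every pivot chosen on the diagonal; that is, $\mathbf{R}_1 := \mathbf{M}$ and, for each executed step $\ell = 1, 2, \dots$, an index $i_\ell \in \{1, \dots, n\}$ is chosen with $\gamma_\ell := \mathbf{R}_\ell[i_\ell, i_\ell] \neq 0$, and $$\mathbf{R}_{\ell+1} := \mathbf{R}_\ell - \frac{1}{\gamma_\ell}\, \mathbf{R}_\ell[:, i_\ell]\, \mathbf{R}_\ell[i_\ell, :].$$ Then every remainder matrix $\mathbf{R}_{\ell+1}$ produced in this way is symmetric positive semi-definite.
   Context: For a matrix $\mathbf{A}$, $\mathbf{A}[:, i]$ denotes its $i$-th column, $\mathbf{A}[j, :]$ its $j$-th row, and $\mathbf{A}[i,j]$ its $(i,j)$ entry. Cross approximation (CA) of a matrix $\mathbf{M}$ is the iterative procedure that starts with the remainder $\mathbf{R}_1 := \mathbf{M}$ and at step $\ell$ selects a pivot position $(i_\ell, j_\ell)$ with nonzero pivot value $\gamma_\ell := \mathbf{R}_\ell[i_\ell, j_\ell]$, then subtracts from the remainder the rank-one matrix formed by the pivot column and pivot row: $\mathbf{R}_{\ell+1} := \mathbf{R}_\ell - \gamma_\ell^{-1}\mathbf{R}_\ell[:, j_\ell]\,\mathbf{R}_\ell[i_\ell, :]$. Choosing the pivot on the diagonal means $j_\ell = i_\ell$. *)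

(* Defs.v *)
From mathcomp Require Import all_boot all_order all_algebra.
From mathcomp Require Import reals.

Set Implicit Arguments.
Unset Strict Implicit.
Unset Printing Implicit Defensive.

Import Order.TTheory GRing.Theory Num.Theory.
Local Open Scope ring_scope.

Definition sym_psd (R : realType) (n : nat) (A : 'M[R]_n) : Prop :=
  A \is symmetricmx /\ forall x : 'cV[R]_n, 0 <= (x^T *m A *m x) 0 0.

Definition ca_step (R : realType) (m n : nat) (A : 'M[R]_(m, n))
    (i : 'I_m) (j : 'I_n) : 'M[R]_(m, n) :=
  A - (A i j)^-1 *: (col j A *m row i A).

(* A run of [L] steps, numbered from 1: step [l] pivots at [(i l, j l)] and
   turns [Rem l] into [Rem l.+1].  The values of [i] and [j] outside [1 .. L],
   and those of [Rem] outside [1 .. L.+1], are unconstrained. *)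
Definition cross_approximation (R : realType) (m n : nat) (M : 'M[R]_(m, n))
    (L : nat) (i : nat -> 'I_m) (j : nat -> 'I_n)
    (Rem : nat -> 'M[R]_(m, n)) : Prop :=
  Rem 1%N = M /\
  forall l : nat, (1 <= l <= L)%N ->
    Rem l (i l) (j l) != 0 /\ Rem l.+1 = ca_step (Rem l) (i l) (j l).

(* Main.v *)
(** Since the pivot column of the updated remainder vanishes, a diagonal step is
    a congruence: A' = Q A Q^T with Q = 1 - gamma^-1 A e e^T.  Congruence
    preserves positive semi-definiteness. *)
Require Import Defs.
From mathcomp Require Import all_boot all_order all_algebra.
From mathcomp Require Import reals.

Import Order.TTheory GRing.Theory Num.Theory.
Local Open Scope ring_scope.

(** Left multiplication by Q already performs the step and clears the pivot column, so multiplying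
    by Q^T on the right changes nothing ([ca_step_congr]). The form of Q A Q^T at x is that of A at
    Q^T x ([sym_psd_congr]); induct on the steps. *)

Lemma symmetricmxP (R : realType) (n : nat) (A : 'M[R]_n) :
  reflect (A^T = A) (A \is symmetricmx).
Proof.
(* [symmetricmx] is the hermitian predicate with sign (-1)^0 and identity conjugation. *)
by apply: (iffP (is_hermitianmxP _ _ _)); rewrite expr0 scale1r map_mx_id // => /esym.
Qed.

Lemma sym_psd_congr (R : realType) (m n : nat) (Q : 'M[R]_(m, n)) (A : 'M[R]_n) :
  sym_psd A -> sym_psd (Q *m A *m Q^T).
Proof.
move=> [/symmetricmxP symA posA]; split.
  by apply/symmetricmxP; rewrite !trmx_mul trmxK symA mulmxA.
by move=> x; have := posA (Q^T *m x); rewrite trmx_mul trmxK !mulmxA.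
Qed.

Lemma col_ca_step (R : realType) (m n : nat) (A : 'M[R]_(m, n)) i j :
  A i j != 0 -> col j (ca_step A i j) = 0.
Proof.
move=> Aij; apply/colP => k.
by rewrite !mxE big_ord1 !mxE mulrC mulfK // subrr.
Qed.

Lemma ca_step_congr (R : realType) (n : nat) (A : 'M[R]_n) i :
    A \is symmetricmx -> A i i != 0 ->
  let Q := 1%:M - (A i i)^-1 *: (col i A *m delta_mx 0 i) in
  ca_step A i i = Q *m A *m Q^T.
Proof.
move=> /symmetricmxP symA Aii Q.
have -> : Q *m A = ca_step A i i.
  by rewrite mulmxBl mul1mx -scalemxAl -mulmxA -rowE.
(* By symmetry the transposed pivot column is the pivot row, so Q^T = 1 - gamma^-1 e (row i A);
   applied on the right, it only subtracts a multiple of column i of the new remainder times that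
   row, and this column is zero. *)
rewrite linearB linearZ /= trmx1 trmx_mul tr_col symA trmx_delta.
rewrite mulmxBr mulmx1 -scalemxAr mulmxA -colE col_ca_step //.
by rewrite mul0mx scaler0 subr0.
Qed.

Lemma sym_psd_ca_step (R : realType) (n : nat) (A : 'M[R]_n) i :
  sym_psd A -> A i i != 0 -> sym_psd (ca_step A i i).
Proof.
by move=> psdA Aii; rewrite (ca_step_congr _ _ _ _ psdA.1 Aii); apply: sym_psd_congr.
Qed.

Theorem proposition1 (R : realType) (n : nat) (M : 'M[R]_n)
    (L : nat) (i : nat -> 'I_n) (Rem : nat -> 'M[R]_n) :
  sym_psd M ->
  cross_approximation M L i i Rem ->
  forall l : nat, (1 <= l <= L)%N -> sym_psd (Rem l.+1).
Proof.
(* The induction starts at l = 0, where [Rem 1] is [M]. *)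
move=> psdM [Rem1 step] l /andP[_]; elim: l => [|l IHl] lL; first by rewrite Rem1.
have [piv ->] := step l.+1 lL.
by apply: sym_psd_ca_step piv; apply/IHl/ltnW.
Qed.
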